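(* Let $V$ be a Banach space whose algebraic tensor powers carry norms as described in the context, let $p\ge1$, $T>0$, and let $x:[0,T]\to G^{(\lfloor p\rfloor)}$ be a $p$-weakly geometric rough path. Define $\overleftarrow{x}:[0,T]\to G^{(\lfloor p\rfloor)}$ by $\overleftarrow{x}_t=x_{T-t}$. Then $$S(\overleftarrow{x})_{0,T}=S(x)_{0,T}^{-1}.$$
   Context: $V$ is a Banach space; $V^{\otimes_a k}$ is the $k$-fold algebraic tensor power of $V$ ($V^{\otimes_a 1}=V$). Each $V^{\otimes_a k}$ carries a norm $\|\cdot\|_{V^{\otimes_a k}}$ such that: (1) $\|a\otimes b\|_{V^{\otimes_a(m+n)}}\le \|a\|_{V^{\otimes_a m}}\|b\|_{V^{\otimes_a n}}$ for $a\in V^{\otimes_a m}$, $b\in V^{\otimes_a n}$; (2) for every $n\in\mathbb{N}$, every permutation $\sigma$ of $\{1,\dots,n\}$ and all $v_1,\dots,v_n\in V$, $\|v_1\otimes\cdots\otimes v_n\|_{V^{\otimes_a n}}=\|v_{\sigma(1)}\otimes\cdots\otimes v_{\sigma(n)}\|_{V^{\otimes_a n}}$. $V^{\otimes k}$ denotes the completion of $V^{\otimes_a k}$; multiplication $\otimes$ extends to $V^{\otimes m}\times V^{\otimes n}\to V^{\otimes (m+n)}$. $\tilde{T}^{(n)}(V)=1\oplus V\oplus\cdots\oplus V^{\otimes n}$ is the set of truncated tensor series $a=(a_0,\dots,a_n)$ with $a_0=1$, $a_k\in V^{\otimes k}$, a group under truncated multiplication $(a\otimes b)_k=\sum_{i=0}^k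 a_i\otimes b_{k-i}$, with identity $\mathbf{1}=(1,0,\dots,0)$; $\tilde{T}((V))$ is the analogous group of infinite series $(a_j)_{j\ge0}$ with $a_0=1$. Inverses are taken in these groups. $\pi^{(n)}$ and $\pi_n$ are the projections onto $\tilde{T}^{(n)}(V)$ and $V^{\otimes n}$. Define $\|g\|_{\tilde{T}^{(n)}(V)}=\max_{1\le k\le n}\|\pi_k(g)\|_{V^{\otimes k}}^{1/k}$. Let $[x,y]=x\otimes y-y\otimes x$, $L_a^1(V)=V$, $L_a^{k+1}(V)=\mathrm{Span}\{[x,y]:x\in L_a^k(V),\,y\in V\}$, $\mathcal{L}_a^n(V)=\bigoplus_{i=1}^n L_a^i(V)$, $\exp(l)=\sum_{j=0}^n l^{\otimes j}/j!$ truncated to degrees at most $n$ ($l^{\otimes 0}=\mathbf{1}$), and let $G^{(\lfloor p\rfloor)}$ be the closure of $\exp\mathcal{L}_a^{\lfloor p\rfloor}(V)$ in $\tilde{T}^{(\lfloor p\rfloor)}(V)$. A path $x:[0,T]\to\tilde{T}^{(n)}(V)$ has finite $p$-variation if $\sup_{\mathcal{P}}\big(\sum_{t_j\in\mathcal{P}}\|x_{t_j}^{-1}x_{t_{j+1}}\|_{\tilde{T}^{(n)}(V)}^p\big)^{1/p}<\infty$, the supremum being over finite partitions $\mathcal{P}$ of $[0,T]$. A path $x:[0,T]\to\tilde{T}^{(\lfloor p\rfloor)}(V)$ is a $p$-weakly geometric rough path if $x_t\in G^{(\lfloor p\rfloor)}$ for all $t$ and $x$ has finite $p$-variation. Signature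 (Lyons): for a $p$-weakly geometric rough path $x$ and $n\ge\lfloor p\rfloor$ there exists a unique $S_n(x)_{0,\cdot}:[0,T]\to\tilde{T}^{(n)}(V)$ of finite $p$-variation with $S_n(x)_{0,0}=\mathbf{1}$ and $\pi^{(\lfloor p\rfloor)}(S_n(x)_{0,t})=x_0^{-1}x_t$ for all $t$. The signature $S(x)_{0,T}\in\tilde{T}((V))$ is the unique element with $\pi^{(n)}(S(x)_{0,T})=S_n(x)_{0,T}$ for all $n\ge\lfloor p\rfloor$.
   Formalization: The p-weakly geometric rough path x and its lifts S_n(x) are required to be continuous on [0,T]; without continuity the lift of finite p-variation is not unique, since jumps in tensor degrees above p are allowed, so S(x) would be undefined. *)

(* Defs.v *)
From HB Require Import structures.
From mathcomp Require Import all_boot all_order all_algebra all_fingroup.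
From mathcomp Require Import all_classical all_reals all_analysis.

Set Implicit Arguments.
Unset Strict Implicit.
Unset Printing Implicit Defensive.

Import Order.TTheory GRing.Theory Num.Theory.
Import numFieldNormedType.Exports.

Local Open Scope classical_set_scope.
Local Open Scope ring_scope.

Definition multilinear (R : realType) (V W : lmodType R) (k : nat)
    (f : k.-tuple V -> W) : Prop :=
  forall (i : 'I_k) (v : k.-tuple V),
    linear (fun u => f [tuple if j == i then u else tnth v j | j < k]).

Definition is_tensor_power (R : realType) (V A : lmodType R) (k : nat)
    (pure : k.-tuple V -> A) : Prop :=
  multilinear pure /\
  forall W : lmodType R,
    (forall g : k.-tuple V -> W, multilinear g ->
       exists h : {linear A -> W}, forall v, h (pure v) = g v) /\
    (forall h h' : {linear A -> W},
       (forall v, h (pure v) = h' (pure v)) -> h =1 h').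

(* Products are indexed by a proof of m + n = k rather than landing in degree
   m + n, so that no transport between degrees is ever needed.  Degree 0 is
   the ground field: it is spanned by the empty tensor, of norm 1. *)
Record normed_tensor_powers (R : realType) (V : normedModType R) := {
  atens :> nat -> normedModType R;
  pure : forall k, k.-tuple V -> atens k;
  pureP : forall k, is_tensor_power (@pure k);
  amul : forall m n k, (m + n)%N = k -> {bilinear atens m -> atens n -> atens k};
  amul_pure : forall m n k (h : (m + n)%N = k)
      (u : m.-tuple V) (v : n.-tuple V),
    amul h (pure u) (pure v) = pure (tcast h (cat_tuple u v));
  norm_pure0 : `|pure [tuple]| = 1;
  norm_pure1 : forall v : V, `|pure [tuple v]| = `|v|;
  norm_amul : forall m n k (h : (m + n)%N = k) (a : atens m) (b : atens n),
    `|amul h a b| <= `|a| * `|b|;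
  norm_pure_perm : forall n (s : 'S_n) (v : n.-tuple V),
    `|pure [tuple tnth v (s i) | i < n]| = `|pure v|
}.

(* emb k exhibits ctens k as the completion of A k; a bilinear map obeying
   norm_cmul is continuous, so cmul is the unique continuous extension of
   amul. *)
Record completed_tensor_powers (R : realType) (V : normedModType R)
    (A : normed_tensor_powers V) := {
  ctens :> nat -> completeNormedModType R;
  emb : forall k, {linear A k -> ctens k};
  norm_emb : forall k (a : A k), `|emb k a| = `|a|;
  dense_emb : forall k, dense (range (emb k));
  cmul : forall m n k, (m + n)%N = k -> {bilinear ctens m -> ctens n -> ctens k};
  cmul_emb : forall m n k (h : (m + n)%N = k) (a : A m) (b : A n),
    cmul h (emb m a) (emb n b) = emb k (amul A h a b);
  norm_cmul : forall m n k (h : (m + n)%N = k) (a : ctens m) (b : ctens n),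
    `|cmul h a b| <= `|a| * `|b|
}.

Section LinearDetermined.
Variables (R : realType) (V : normedModType R).

Lemma eq_on_pure (A : normed_tensor_powers V) (k : nat) (W : lmodType R)
    (f g : A k -> W) : linear f -> linear g ->
  (forall v, f (pure A v) = g (pure A v)) -> f =1 g.
Proof.
move=> lf lg.
pose F : {linear A k -> W} := HB.pack f (GRing.isLinear.Build R _ _ _ f lf).
pose G : {linear A k -> W} := HB.pack g (GRing.isLinear.Build R _ _ _ g lg).
by have [_ /(_ W)[_ u]] := pureP A k => /(u F G).
Qed.

Lemma eq_on_emb (A : normed_tensor_powers V) (E : completed_tensor_powers A)
    (k : nat) (W : normedModType R) (f g : E k -> W) (C D : R) :
  linear f -> linear g ->
  (forall a, `|f a| <= C * `|a|) -> (forall a, `|g a| <= D * `|a|) ->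
  (forall a, f (emb E k a) = g (emb E k a)) -> f =1 g.
Proof.
move=> lf lg bf bg fg x; apply/eqP; rewrite -subr_eq0 -normr_le0.
apply/ler_addgt0Pr => e e0; rewrite add0r.
pose K := `|C| + `|D| + 1.
have K0 : 0 < K by rewrite ltr_wpDl// addr_ge0.
have d0 : 0 < e / K by rewrite divr_gt0.
have : (interior (ball x (e / K))) !=set0.
  by exists x; apply: nbhsx_ballx.
move=> /(@dense_emb _ _ _ E).
move=> /(_ (@open_interior _ _)) [y [+ [a _ yE]]]; rewrite -yE => /interior_subset xa.
have lB (h : E k -> W) : linear h -> forall u v, h u - h v = h (u - v).
  by move=> lh u v; have := lh (-1) v u; rewrite !scaleN1r ![- _ + _]addrC.
have fgx : f x - g x = f (x - emb E k a) - g (x - emb E k a).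
  rewrite -(lB f lf) -(lB g lg) fg opprB addrA; congr (_ + _).
  by rewrite -addrA; rewrite addNr addr0.
rewrite fgx.
have : `|x - emb E k a| <= e / K by apply: ltW; rewrite -ball_normE in xa.
move=> xae; apply: (le_trans (ler_normB _ _)).
apply: (@le_trans _ _ (K * `|x - emb E k a|)); last first.
  by rewrite mulrC -ler_pdivlMr.
rewrite /K !mulrDl -addrA lerD//.
  by apply: (le_trans (bf _)); rewrite ler_wpM2r// ler_norm.
rewrite -[leLHS]addr0 lerD ?mul1r//.
by apply: (le_trans (bg _)); rewrite ler_wpM2r// ler_norm.
Qed.

End LinearDetermined.

Section Products.
Variables (R : realType) (V : normedModType R) (A : normed_tensor_powers V).

Lemma amul_linl m n k (h : (m + n)%N = k) (b : A n) :
  linear (fun a => amul A h a b).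
Proof. by move=> c x y; rewrite linearPl. Qed.

Lemma amul_linr m n k (h : (m + n)%N = k) (a : A m) : linear (amul A h a).
Proof. by move=> c x y; rewrite linearPr. Qed.

Lemma amulA i j k ij jk l (h1 : (i + j)%N = ij) (h2 : (ij + k)%N = l)
    (h3 : (j + k)%N = jk) (h4 : (i + jk)%N = l) (a : A i) (b : A j) (c : A k) :
  amul A h2 (amul A h1 a b) c = amul A h4 a (amul A h3 b c).
Proof.
move: a; apply: eq_on_pure => [r x y|r x y|u].
- by rewrite amul_linl amul_linl.
- by rewrite amul_linl.
move: b; apply: eq_on_pure => [r x y|r x y|v].
- by rewrite amul_linr amul_linl.
- by rewrite amul_linl amul_linr.
move: c; apply: eq_on_pure => [r x y|r x y|w].
- by rewrite amul_linr.
- by rewrite amul_linr amul_linr.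
rewrite !amul_pure; congr (pure _ _).
by apply: val_inj; rewrite /= !val_tcast /= !val_tcast /= catA.
Qed.

Lemma amul1l k (h : (0 + k)%N = k) (a : A k) : amul A h (pure A [tuple]) a = a.
Proof.
move: a; apply: eq_on_pure => [r x y|//|u]; first by rewrite amul_linr.
by rewrite amul_pure; congr (pure _ _); apply: val_inj; rewrite /= val_tcast.
Qed.

Lemma amul1r k (h : (k + 0)%N = k) (a : A k) : amul A h a (pure A [tuple]) = a.
Proof.
move: a; apply: eq_on_pure => [r x y|//|u]; first by rewrite amul_linl.
rewrite amul_pure; congr (pure _ _); apply: val_inj.
by rewrite /= val_tcast /= cats0.
Qed.

Variable E : completed_tensor_powers A.

Lemma cmul_linl m n k (h : (m + n)%N = k) (b : E n) :
  linear (fun a => cmul E h a b).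
Proof. by move=> c x y; rewrite linearPl. Qed.

Lemma cmul_linr m n k (h : (m + n)%N = k) (a : E m) : linear (cmul E h a).
Proof. by move=> c x y; rewrite linearPr. Qed.

Lemma cmulA i j k ij jk l (h1 : (i + j)%N = ij) (h2 : (ij + k)%N = l)
    (h3 : (j + k)%N = jk) (h4 : (i + jk)%N = l) (a : E i) (b : E j) (c : E k) :
  cmul E h2 (cmul E h1 a b) c = cmul E h4 a (cmul E h3 b c).
Proof.
have nl (a' : E i) (b' : E j) (c' : E k) :
    `|cmul E h2 (cmul E h1 a' b') c'| <= `|a'| * `|b'| * `|c'|.
  by apply: (le_trans (norm_cmul _ _ _)); rewrite ler_wpM2r// norm_cmul.
have nr (a' : E i) (b' : E j) (c' : E k) :
    `|cmul E h4 a' (cmul E h3 b' c')| <= `|a'| * `|b'| * `|c'|.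
  apply: (le_trans (norm_cmul _ _ _)).
  by rewrite -mulrA ler_wpM2l// norm_cmul.
move: a; apply: (@eq_on_emb _ _ _ E i _ _ _ (`|b| * `|c|) (`|b| * `|c|)).
- by move=> r x y; rewrite cmul_linl cmul_linl.
- by move=> r x y; rewrite cmul_linl.
- by move=> a; rewrite mulrC mulrA; exact: nl.
- by move=> a; rewrite mulrC mulrA; exact: nr.
move=> a.
move: b; apply: (@eq_on_emb _ _ _ E j _ _ _ (`|emb E i a| * `|c|) (`|emb E i a| * `|c|)).
- by move=> r x y; rewrite cmul_linr cmul_linl.
- by move=> r x y; rewrite cmul_linl cmul_linr.
- by move=> b; rewrite mulrAC; exact: nl.
- by move=> b; rewrite mulrAC; exact: nr.
move=> b.
move: c; apply: (@eq_on_emb _ _ _ E k _ _ _ (`|emb E i a| * `|emb E j b|) (`|emb E i a| * `|emb E j b|)).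
- by move=> r x y; rewrite cmul_linr.
- by move=> r x y; rewrite cmul_linr cmul_linr.
- by move=> c; exact: nl.
- by move=> c; exact: nr.
by move=> c; rewrite !cmul_emb (amulA _ _ h3 h4).
Qed.

Lemma cmul1l k (h : (0 + k)%N = k) (a : E k) :
  cmul E h (emb E 0 (pure A [tuple])) a = a.
Proof.
move: a; apply: (@eq_on_emb _ _ _ E k _ _ _ `|emb E 0 (pure A [tuple])| 1).
- exact: cmul_linr.
- by [].
- by move=> a; exact: norm_cmul.
- by move=> a; rewrite mul1r.
- by move=> a; rewrite cmul_emb amul1l.
Qed.

Lemma cmul1r k (h : (k + 0)%N = k) (a : E k) :
  cmul E h a (emb E 0 (pure A [tuple])) = a.
Proof.
move: a; apply: (@eq_on_emb _ _ _ E k _ _ _ `|emb E 0 (pure A [tuple])| 1).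
- exact: cmul_linl.
- by [].
- by move=> a; rewrite mulrC; exact: norm_cmul.
- by move=> a; rewrite mul1r.
- by move=> a; rewrite cmul_emb amul1r.
Qed.

End Products.

(* T((V)): all series, without condition on the degree 0 coefficient; the
   product topology of the norms. *)
Definition tser (R : realType) (V : normedModType R)
  (A : normed_tensor_powers V) (E : completed_tensor_powers A) : Type :=
  prod_topology (fun k => E k).

Section Series.
Variables (R : realType) (V : normedModType R) (A : normed_tensor_powers V).
Variable E : completed_tensor_powers A.
Implicit Types a b c : tser E.

HB.instance Definition _ :=
  Topological.copy (tser E) (prod_topology (fun k => E k)).

Definition sadd a b : tser E := fun k => a k + b k.
Definition sopp a : tser E := fun k => - a k.
Definition szero : tser E := fun=> 0.
Definition sscale (r : R) a : tser E := fun k => r *: a k.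

Lemma tser_ext a b : (forall k, a k = b k) -> a = b.
Proof. by move=> ?; exact: functional_extensionality_dep. Qed.

Lemma saddA : associative sadd.
Proof. by move=> a b c; apply: tser_ext => k; exact: addrA. Qed.
Lemma saddC : commutative sadd.
Proof. by move=> a b; apply: tser_ext => k; exact: addrC. Qed.
Lemma sadd0 : left_id szero sadd.
Proof. by move=> a; apply: tser_ext => k; exact: add0r. Qed.
Lemma saddN : left_inverse szero sopp sadd.
Proof. by move=> a; apply: tser_ext => k; exact: addNr. Qed.

HB.instance Definition _ :=
  GRing.isZmodule.Build (tser E) saddA saddC sadd0 saddN.

Lemma serD a b k : (a + b) k = a k + b k. Proof. by []. Qed.
Lemma serN a k : (- a) k = - a k. Proof. by []. Qed.
Lemma ser0 k : (0 : tser E) k = 0. Proof. by []. Qed.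
Lemma ser_sum I (r : seq I) P (F : I -> tser E) k :
  (\sum_(i <- r | P i) F i) k = \sum_(i <- r | P i) F i k.
Proof. exact: (big_morph (fun a : tser E => a k)). Qed.

Lemma sscaleA r s a : sscale r (sscale s a) = sscale (r * s) a.
Proof. by apply: tser_ext => k; exact: scalerA. Qed.
Lemma sscale1 : left_id 1 sscale.
Proof. by move=> a; apply: tser_ext => k; exact: scale1r. Qed.
Lemma sscaleDr : right_distributive sscale +%R.
Proof. by move=> r a b; apply: tser_ext => k; exact: scalerDr. Qed.
Lemma sscaleDl a : {morph sscale^~ a : r s / r + s >-> r + s}.
Proof. by move=> r s; apply: tser_ext => k; exact: scalerDl. Qed.

HB.instance Definition _ := GRing.Zmodule_isLmodule.Build R (tser E)
  sscaleA sscale1 sscaleDr sscaleDl.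

Lemma serZ r a k : (r *: a) k = r *: a k. Proof. by []. Qed.

Definition smul a b : tser E := fun k =>
  \sum_(i < k.+1) cmul E (subnKC (leq_ord i)) (a i) (b (k - i)%N).

Definition sone : tser E := fun k =>
  if k is 0 then emb E 0 (pure A [tuple]) else 0.

(* The product extended by 0 to mismatched degrees, a proof device only. *)
Definition pmul i j k (x : E i) (y : E j) : E k :=
  if (i + j)%N =P k is ReflectT h then cmul E h x y else 0.

Lemma pmulE i j k (h : (i + j)%N = k) (x : E i) (y : E j) :
  pmul k x y = cmul E h x y.
Proof. by rewrite /pmul; case: eqP => // h'; rewrite (eq_irrelevance h' h). Qed.

Lemma pmul0 i j k (x : E i) (y : E j) : (i + j)%N != k -> pmul k x y = 0.
Proof. by rewrite /pmul; case: eqP. Qed.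

Lemma pmul_linl i j k (y : E j) : linear (fun x : E i => pmul k x y).
Proof.
move=> r x x'; rewrite /pmul; case: eqP => [h|_]; first exact: cmul_linl.
by rewrite scaler0 addr0.
Qed.

Lemma pmul_linr i j k (x : E i) : linear (pmul k x : E j -> E k).
Proof.
move=> r y y'; rewrite /pmul; case: eqP => [h|_]; first exact: cmul_linr.
by rewrite scaler0 addr0.
Qed.

Lemma lin_sum (W W' : lmodType R) (f : W -> W') : linear f ->
  forall I (r : seq I) P F, f (\sum_(i <- r | P i) F i) =
    \sum_(i <- r | P i) f (F i).
Proof.
move=> lf I r P F.
pose G : {linear W -> W'} := HB.pack f (GRing.isLinear.Build R _ _ _ f lf).
exact: (raddf_sum G).
Qed.

Lemma smulE N a b k : (k < N)%N ->
  smul a b k = \sum_(i < N) \sum_(j < N) pmul k (a i) (b j).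
Proof.
move=> kN; rewrite /smul.
under eq_bigr do rewrite -pmulE.
rewrite (big_ord_widen N (fun i => pmul k (a i) (b (k - i)%N)))//.
rewrite big_mkcond/=; apply: eq_bigr => i _; rewrite ltnS.
case: leqP => ik; last first.
  rewrite big1// => j _; apply: pmul0.
  by rewrite gtn_eqF// (leq_trans ik)// leq_addr.
have kiN : (k - i < N)%N by rewrite (leq_ltn_trans _ kN)// leq_subr.
rewrite (bigD1 (Ordinal kiN))//= big1 ?addr0// => j jki.
apply: pmul0; apply: contra jki => /eqP ijk.
by apply/eqP/val_inj; rewrite /= -ijk addKn.
Qed.

Lemma pmul0l i j k (y : E j) : pmul k (0 : E i) y = 0.
Proof. by rewrite /pmul; case: eqP => // h; rewrite linear0l. Qed.

Lemma pmul0r i j k (x : E i) : pmul k x (0 : E j) = 0.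
Proof. by rewrite /pmul; case: eqP => // h; rewrite linear0r. Qed.

Lemma pmulA N i j l k (x : E i) (y : E j) (z : E l) : (k < N)%N ->
  \sum_(m < N) pmul k (pmul m x y) z = \sum_(m < N) pmul k x (pmul m y z).
Proof.
move=> kN; have [ijlk|ijlk] := eqVneq (i + j + l)%N k; last first.
  rewrite !big1// => m _.
    have [e|ne] := eqVneq (j + l)%N m; last by rewrite (pmul0 _ _ ne) pmul0r.
    by rewrite pmul0//; apply: contra ijlk => /eqP <-; rewrite -e addnA.
  have [e|ne] := eqVneq (i + j)%N m; last by rewrite (pmul0 _ _ ne) pmul0l.
  by rewrite pmul0//; apply: contra ijlk => /eqP <-; rewrite -e.
have ijN : (i + j < N)%N by rewrite (leq_ltn_trans _ kN)// -ijlk leq_addr.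
have jlN : (j + l < N)%N.
  by rewrite (leq_ltn_trans _ kN)// -ijlk -addnA leq_addl.
rewrite (bigD1 (Ordinal ijN))//= big1 ?addr0; last first.
  move=> m mij; rewrite (pmul0 (k := m)) ?pmul0l//.
  by apply: contra mij => /eqP ?; apply/eqP/val_inj.
rewrite (bigD1 (Ordinal jlN))//= big1 ?addr0; last first.
  move=> m mij; rewrite (pmul0 (k := m)) ?pmul0r//.
  by apply: contra mij => /eqP ?; apply/eqP/val_inj.
rewrite !pmulE; first by rewrite addnA.
by move=> ijlk'; exact: cmulA.
Qed.

Lemma smulA : associative smul.
Proof.
move=> a b c; apply: tser_ext => k.
rewrite !(@smulE k.+1)//.
transitivity (\sum_(i < k.+1) \sum_(j < k.+1) \sum_(l < k.+1)
    \sum_(m < k.+1) pmul k (a i) (pmul m (b j) (c l))).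
  apply: eq_bigr => i _.
  under eq_bigr => m _.
    rewrite (@smulE k.+1)// (lin_sum (@pmul_linr _ _ _ _)).
    under eq_bigr do rewrite (lin_sum (@pmul_linr _ _ _ _)).
    over.
  rewrite exchange_big; apply: eq_bigr => j _.
  by rewrite exchange_big.
transitivity (\sum_(i < k.+1) \sum_(j < k.+1) \sum_(l < k.+1)
    \sum_(m < k.+1) pmul k (pmul m (a i) (b j)) (c l)).
  do 3!apply: eq_bigr => ? _; by rewrite pmulA.
symmetry.
under eq_bigr => m _.
  under eq_bigr => l _.
    rewrite (@smulE k.+1)// (lin_sum (@pmul_linl _ _ _ _)).
    under eq_bigr do rewrite (lin_sum (@pmul_linl _ _ _ _)).
    over.
  rewrite exchange_big /=.
  under eq_bigr do rewrite exchange_big /=.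
  over.
rewrite exchange_big; apply: eq_bigr => i _.
rewrite exchange_big; apply: eq_bigr => j _.
by rewrite exchange_big.
Qed.

Lemma smul1l : left_id sone smul.
Proof.
move=> a; apply: tser_ext => k; rewrite (@smulE k.+1)//.
rewrite big_ord_recl [X in _ + X]big1 ?addr0; last first.
  by move=> i _; rewrite big1// => j _; rewrite pmul0l.
rewrite big_ord_recr/= big1 ?add0r; last first.
  by move=> j _; rewrite pmul0// add0n ltn_eqF//=.
by rewrite pmulE cmul1l.
Qed.

Lemma smul1r : right_id sone smul.
Proof.
move=> a; apply: tser_ext => k; rewrite (@smulE k.+1)//.
rewrite exchange_big/= big_ord_recl/= [X in _ + X]big1 ?addr0; last first.
  by move=> i _; rewrite big1// => j _; rewrite pmul0r.
rewrite big_ord_recr/= big1 ?add0r; last first.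
  by move=> j _; rewrite pmul0// addn0 ltn_eqF//=.
by rewrite pmulE ?addn0// => h; rewrite cmul1r.
Qed.

Lemma smulDl : left_distributive smul +%R.
Proof.
move=> a b c; apply: tser_ext => k; rewrite serD /smul -big_split/=.
by apply: eq_bigr => i _; rewrite /= serD linearDl.
Qed.

Lemma smulDr : right_distributive smul +%R.
Proof.
move=> a b c; apply: tser_ext => k; rewrite serD /smul -big_split/=.
by apply: eq_bigr => i _; rewrite serD linearDr.
Qed.

HB.instance Definition _ := GRing.Zmodule_isPzRing.Build (tser E)
  smulA smul1l smul1r smulDl smulDr.

Lemma serM a b k :
  (a * b) k = \sum_(i < k.+1) cmul E (subnKC (leq_ord i)) (a i) (b (k - i)%N).
Proof. by []. Qed.

Lemma ser1 k : (1 : tser E) k = sone k. Proof. by []. Qed.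

End Series.

Section Groups.
Variables (R : realType) (V : normedModType R) (A : normed_tensor_powers V).
Variable E : completed_tensor_powers A.

Lemma smul_agree n (a a' b b' : tser E) :
  (forall k, (k <= n)%N -> a k = a' k) ->
  (forall k, (k <= n)%N -> b k = b' k) ->
  forall k, (k <= n)%N -> (a * b) k = (a' * b') k.
Proof.
move=> aa bb k kn; rewrite !serM; apply: eq_bigr => i _.
rewrite aa ?bb//; first by rewrite (leq_trans _ kn)// leq_subr.
by rewrite (leq_trans _ kn)// leq_ord.
Qed.

Lemma ser_exp_lt (u : tser E) j i : u 0%N = 0 -> (i < j)%N -> (u ^+ j) i = 0.
Proof.
move=> u0; elim: j i => // j ih i ij; rewrite exprS serM big1// => m _.
have [m0|m0] := posnP m.
  have -> : u m = 0 by case: m m0 => -[].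
  by rewrite linear0l.
rewrite ih ?linear0r// (leq_trans _ (ij : (i <= j)%N))// ltn_subrL m0.
by rewrite (leq_trans m0)// leq_ord.
Qed.

Definition sinv (a : tser E) : tser E :=
  fun k => (\sum_(j < k.+1) (1 - a) ^+ j) k.

Lemma sinvE n (a : tser E) k : a 0%N = (1 : tser E) 0%N -> (k <= n)%N ->
  sinv a k = (\sum_(j < n.+1) (1 - a) ^+ j) k.
Proof.
move=> a0 kn; rewrite /sinv !ser_sum.
rewrite (big_ord_widen n.+1 (fun j => ((1 - a) ^+ j) k))// big_mkcond/=.
apply: eq_bigr => j _; case: ltnP => // kj; rewrite ser_exp_lt//.
by rewrite serD serN a0 subrr.
Qed.

Lemma smulV (a : tser E) : a 0%N = (1 : tser E) 0%N -> a * sinv a = 1.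
Proof.
move=> a0; apply: tser_ext => n.
rewrite (@smul_agree n a a _ (\sum_(j < n.+1) (1 - a) ^+ j))//; last first.
  by move=> k; exact: sinvE.
have {1}-> : a = - ((1 - a) - 1) by rewrite addrAC subrr add0r opprK.
rewrite mulNr -subrX1 opprB serD serN ser_exp_lt ?subr0//.
by rewrite serD serN a0 subrr.
Qed.

Lemma sinvM (a : tser E) : a 0%N = (1 : tser E) 0%N -> sinv a * a = 1.
Proof.
move=> a0; apply: tser_ext => n.
rewrite (@smul_agree n _ (\sum_(j < n.+1) (1 - a) ^+ j) a a)//; last first.
  by move=> k; exact: sinvE.
have <- : GRing.comm a (\sum_(j < n.+1) (1 - a) ^+ j).
  apply: commr_sum => j _; apply: commrX.
  by apply: commrB; [exact: commr1|].
rewrite -[in RHS](smulV a0); apply: (@smul_agree n) => // k kn.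
by rewrite (@sinvE n).
Qed.

Lemma smul0 (a b : tser E) : a 0%N = (1 : tser E) 0%N ->
  b 0%N = (1 : tser E) 0%N -> (a * b) 0%N = (1 : tser E) 0%N.
Proof.
by move=> a0 b0; rewrite serM big_ord1/= a0 b0 cmul1l.
Qed.

Lemma sinv0 (a : tser E) : sinv a 0%N = (1 : tser E) 0%N.
Proof. by rewrite /sinv big_ord1 expr0. Qed.

Record tgroup := Tgroup {
  tser_of :> tser E;
  tser_of0 : tser_of 0%N = (1 : tser E) 0%N }.

Lemma tgroup_ext (a b : tgroup) : (forall k, tser_of a k = tser_of b k) -> a = b.
Proof.
case: a b => [a a0] [b b0] /= ab.
have {}ab : a = b by exact: tser_ext.
by rewrite ab in a0 *; congr Tgroup; exact: Prop_irrelevance.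
Qed.

HB.instance Definition _ := gen_eqMixin tgroup.
HB.instance Definition _ := gen_choiceMixin tgroup.

Definition tgroup_one := @Tgroup 1 erefl.
Definition tgroup_mul (a b : tgroup) :=
  @Tgroup (tser_of a * tser_of b) (smul0 (tser_of0 a) (tser_of0 b)).
Definition tgroup_inv (a : tgroup) := @Tgroup (sinv a) (sinv0 a).

Lemma tgroup_mulA : associative tgroup_mul.
Proof. by move=> a b c; apply: tgroup_ext => k /=; rewrite mulrA. Qed.
Lemma tgroup_mul1 : left_id tgroup_one tgroup_mul.
Proof. by move=> a; apply: tgroup_ext => k /=; rewrite mul1r. Qed.
Lemma tgroup_1mul : right_id tgroup_one tgroup_mul.
Proof. by move=> a; apply: tgroup_ext => k /=; rewrite mulr1. Qed.
Lemma tgroup_mulV : left_inverse tgroup_one tgroup_inv tgroup_mul.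
Proof.
by move=> a; apply: tgroup_ext => k /=; rewrite sinvM//; exact: tser_of0.
Qed.
Lemma tgroup_Vmul : right_inverse tgroup_one tgroup_inv tgroup_mul.
Proof.
by move=> a; apply: tgroup_ext => k /=; rewrite smulV//; exact: tser_of0.
Qed.

HB.instance Definition _ := isGroup.Build tgroup
  tgroup_mulA tgroup_mul1 tgroup_1mul tgroup_mulV tgroup_Vmul.

(* Truncated series are stored as series that vanish above degree n; their
   product truncates the product of series. *)
Record trunc_tgroup (n : nat) := TruncTgroup {
  tgroup_of :> tgroup;
  tgroup_ofP : forall k, (n < k)%N -> tser_of tgroup_of k = 0 }.

Section Truncated.
Variable n : nat.

Lemma trunc_tgroup_ext (a b : trunc_tgroup n) :
  (forall k, (k <= n)%N -> tser_of a k = tser_of b k) -> a = b.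
Proof.
case: a b => [a aP] [b bP] /= ab.
have {}ab : a = b.
  by apply: tgroup_ext => k; case: (leqP k n) => [/ab//|kn]; rewrite aP// bP.
by rewrite ab in aP *; congr TruncTgroup; exact: Prop_irrelevance.
Qed.

Definition ser_trunc (a : tser E) : tser E :=
  fun k => if (k <= n)%N then a k else 0.

Lemma ser_trunc_gt a k : (n < k)%N -> ser_trunc a k = 0.
Proof. by move=> nk; rewrite /ser_trunc leqNgt nk. Qed.

Definition tproj (a : tgroup) : trunc_tgroup n :=
  @TruncTgroup n (@Tgroup (ser_trunc a) (tser_of0 a)) (@ser_trunc_gt a).

Lemma tprojE a k : (k <= n)%N -> tser_of (tproj a) k = tser_of a k.
Proof. by rewrite /= /ser_trunc => ->. Qed.

HB.instance Definition _ := gen_eqMixin (trunc_tgroup n).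
HB.instance Definition _ := gen_choiceMixin (trunc_tgroup n).

HB.instance Definition _ := Topological.copy (trunc_tgroup n)
  (initial_topology (fun g : trunc_tgroup n => g : tser E)).

Lemma coef_continuous k : continuous (fun g : trunc_tgroup n => tser_of g k).
Proof.
move=> g; apply: (@continuous_comp (trunc_tgroup n) (tser E) (E k)
    (fun g => tser_of g) (fun a => a k)).
  exact: initial_continuous.
exact: (@proj_continuous nat (fun k => E k) k).
Qed.

Definition trunc_one := tproj 1%g.
Definition trunc_mul (a b : trunc_tgroup n) := tproj (tgroup_of a * tgroup_of b)%g.
Definition trunc_inv (a : trunc_tgroup n) := tproj (tgroup_of a)^-1%g.

Lemma trunc_mulA : associative trunc_mul.
Proof.
move=> a b c; apply: trunc_tgroup_ext => k kn; rewrite !tprojE//.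
transitivity (tser_of (tgroup_of a * (tgroup_of b * tgroup_of c))%g k).
  by apply: (@smul_agree n) => // j jn; rewrite tprojE.
rewrite mulgA; symmetry.
by apply: (@smul_agree n) => // j jn; rewrite tprojE.
Qed.
Lemma trunc_mul1 : left_id trunc_one trunc_mul.
Proof.
move=> a; apply: trunc_tgroup_ext => k kn; rewrite tprojE//.
rewrite -[in RHS](mul1g (tgroup_of a)).
by apply: (@smul_agree n) => // j jn; rewrite tprojE.
Qed.
Lemma trunc_1mul : right_id trunc_one trunc_mul.
Proof.
move=> a; apply: trunc_tgroup_ext => k kn; rewrite tprojE//.
rewrite -[in RHS](mulg1 (tgroup_of a)).
by apply: (@smul_agree n) => // j jn; rewrite tprojE.
Qed.
Lemma trunc_mulV : left_inverse trunc_one trunc_inv trunc_mul.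
Proof.
move=> a; apply: trunc_tgroup_ext => k kn; rewrite !tprojE//.
rewrite -(mulVg (tgroup_of a)).
by apply: (@smul_agree n) => // j jn; rewrite tprojE.
Qed.
Lemma trunc_Vmul : right_inverse trunc_one trunc_inv trunc_mul.
Proof.
move=> a; apply: trunc_tgroup_ext => k kn; rewrite !tprojE//.
rewrite -(mulgV (tgroup_of a)).
by apply: (@smul_agree n) => // j jn; rewrite tprojE.
Qed.

HB.instance Definition _ := isGroup.Build (trunc_tgroup n)
  trunc_mulA trunc_mul1 trunc_1mul trunc_mulV trunc_Vmul.

End Truncated.
End Groups.

Definition lspan (R : realType) (W : lmodType R) (S : set W) : set W :=
  [set w | exists (m : nat) (c : 'I_m -> R) (s : 'I_m -> W),
     (forall i, S (s i)) /\ w = \sum_(i < m) c i *: s i].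

Section Signature.
Variables (R : realType) (V : normedModType R) (A : normed_tensor_powers V).
Variable E : completed_tensor_powers A.

Definition ser_of_vec (v : V) : tser E :=
  fun k => if k is 1 then emb E 1 (pure A [tuple v]) else 0.

(* lie k is L_a^k(V), for k >= 1. *)
Fixpoint lie (k : nat) : set (tser E) :=
  match k with
  | 0 => [set 0]
  | 1 => range ser_of_vec
  | k'.+1 => lspan [set x * y - y * x | x in lie k' & y in range ser_of_vec]
  end.

Definition lie_upto (n : nat) : set (tser E) :=
  [set l | exists f : nat -> tser E,
     (forall i, (1 <= i <= n)%N -> lie i (f i)) /\ l = \sum_(1 <= i < n.+1) f i].

Definition ser_exp (n : nat) (l : tser E) : tser E :=
  \sum_(j < n.+1) (j`!%:R^-1 : R) *: l ^+ j.

Definition Ggroup (n : nat) : set (trunc_tgroup E n) :=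
  closure [set g : trunc_tgroup E n | exists2 l, lie_upto n l &
    forall k, (k <= n)%N -> tser_of g k = ser_exp n l k].

Definition hnorm (n : nat) (g : trunc_tgroup E n) : R :=
  \big[Num.max/0]_(1 <= k < n.+1) `|tser_of g k| `^ k%:R^-1.

Definition pvariation (p a b : R) (n : nat) (x : R -> trunc_tgroup E n)
    (s : seq R) : R :=
  let t := nth b (a :: s) in
  (\sum_(0 <= j < size s) hnorm ((x (t j))^-1 * x (t j.+1))%g `^ p) `^ p^-1.

Definition finite_pvariation (p T : R) (n : nat)
    (x : R -> trunc_tgroup E n) : Prop :=
  has_ubound [set pvariation p 0 T x s | s in itv_partition 0 T].

(* Paths are functions on R of which only the restriction to [0, T] matters;
   a path is understood to be continuous, without which lifts of finite
   p-variation would not be unique. *)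
Definition weakly_geometric_rough_path (p T : R)
    (x : R -> trunc_tgroup E (Num.truncn p)) : Prop :=
  [/\ {within `[0, T], continuous x},
      forall t, t \in `[0, T] -> Ggroup (x t)
    & finite_pvariation p T x].

Definition is_lift (p T : R) (x : R -> trunc_tgroup E (Num.truncn p)) (n : nat)
    (y : R -> trunc_tgroup E n) : Prop :=
  [/\ {within `[0, T], continuous y},
      finite_pvariation p T y,
      y 0 = 1%g
    & forall t, t \in `[0, T] ->
        tproj (Num.truncn p) (y t) = ((x 0)^-1 * x t)%g].

(* By Lyons' extension theorem, for n >= truncn p a lift of a weakly geometric
   rough path exists and is unique on [0, T], so that the default value of
   xget is not used; likewise for the signature. *)
Definition lyons_lift (p T : R) (x : R -> trunc_tgroup E (Num.truncn p)) (n : nat) :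
    R -> trunc_tgroup E n :=
  xget (fun=> 1%g) [set y | @is_lift p T x n y].

Definition signature (p T : R) (x : R -> trunc_tgroup E (Num.truncn p)) :
    tgroup E :=
  xget 1%g [set S | forall n, (Num.truncn p <= n)%N -> tproj n S = @lyons_lift p T x n T].

Definition reverse (T : R) (n : nat) (x : R -> trunc_tgroup E n) :
    R -> trunc_tgroup E n :=
  fun t => x (T - t).

End Signature.

Arguments weakly_geometric_rough_path {R V A E} p T x.
Arguments is_lift {R V A E} p T x n y.
Arguments lyons_lift {R V A E} p T x n.
Arguments signature {R V A E} p T x.

(* Main.v *)
Require Import Defs.
From mathcomp Require Import all_boot all_order all_algebra all_fingroup.
From mathcomp Require Import all_classical all_reals all_analysis.
Import Order.TTheory GRing.Theory Num.Theory.
Import numFieldNormedType.Exports.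
Local Open Scope ring_scope.

Set Implicit Arguments.
Unset Strict Implicit.
Unset Printing Implicit Defensive.

(** If y lifts x to degree n, then t |-> y_T^-1 y_(T-t) lifts the reversed path
    ([is_lift_reverse]), and its value at T is y_T^-1 y_0 = y_T^-1.  Reversal
    being an involution, x and its reversal either both have a lift in degree n
    or both have none.  In the first case uniqueness of lifts turns the value
    above into the equality of the chosen lifts at T; in the second both chosen
    lifts are the constant path 1.  The same alternative, one level up, passes
    from the lifts to the signatures.

    Two facts carry the argument.

    Uniqueness of continuous lifts ([path_unique]) is the half of Lyons'
    extension theorem that rests on degrees k > p.  Suppose that y and z agree
    in degrees below k.  In the expansion of y_t = y_s (y_s^-1 y_t) in degree k,
    the only terms that involve degree k itself are those of y_s and of the
    increment, so D = y - z has in degree k the increment D_t - D_s equal to the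
    difference of the coefficients of y_s^-1 y_t and z_s^-1 z_t
    ([increment_coef_diff]).  Each of these is at most hnorm ^ k, that is,
    hnorm ^ (k - p) times a term of the p-variation sum.  Since hnorm of the
    increments tends to 0 uniformly with the mesh ([increments_small]), summing
    over finer and finer subdivisions gives D = D_0 = 0.

    Finite p-variation survives reversal ([finite_pvariation_reverse]) because
    the increments of the reversed path are the inverses of those of the path,
    and hnorm (g^-1) <= 2 hnorm g ([hnorm_inv_le]). *)

(** * Coefficients of products and inverses *)

Section Coefficients.
Variables (R : realType) (V : normedModType R) (A : normed_tensor_powers V).
Variable E : completed_tensor_powers A.

Lemma norm_smul_le (a b : tser E) k :
  `|(a * b) k| <= \sum_(i < k.+1) `|a i| * `|b (k - i)%N|.
Proof.
rewrite serM; apply: (le_trans (ler_norm_sum _ _ _)).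
by apply: ler_sum => i _; exact: norm_cmul.
Qed.

(** The two factors have constant term 1, which isolates the only two terms of
    degree k.+1 in one factor. *)
Lemma smul_ends (a b : tser E) k :
  a 0%N = (1 : tser E) 0%N -> b 0%N = (1 : tser E) 0%N ->
  (a * b) k.+1 =
    b k.+1 + \sum_(i < k) pmul k.+1 (a i.+1) (b (k - i)%N) + a k.+1.
Proof.
move=> a0 b0; rewrite serM.
under eq_bigr do rewrite -pmulE.
rewrite big_ord_recl big_ord_recr/= -addrA; congr (_ + (_ + _)).
- by rewrite pmulE a0 cmul1l.
- by rewrite subnn b0 pmulE ?addn0// => h; rewrite cmul1r.
Qed.

Lemma norm_coef0 (g : tgroup E) : `|tser_of g 0| = 1.
Proof. by rewrite tser_of0 /= norm_emb norm_pure0. Qed.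

Variable n : nat.
Implicit Types g h : trunc_tgroup E n.

Lemma trunc_mulE g h k : (k <= n)%N ->
  tser_of (g * h)%g k = ((tser_of g : tser E) * tser_of h) k.
Proof. exact: tprojE. Qed.

Lemma tproj_mul m g h : (m <= n)%N ->
  tproj m (g * h)%g = (tproj m g * tproj m h)%g.
Proof.
move=> mn; apply: trunc_tgroup_ext => k km.
rewrite tprojE// trunc_mulE ?(leq_trans km)// [RHS]tprojE//.
by apply: (@smul_agree _ _ _ E m) => // j jm; rewrite tprojE.
Qed.

Lemma tproj_one m : (m <= n)%N -> tproj m (1%g : trunc_tgroup E n) = 1%g.
Proof.
move=> mn; apply: trunc_tgroup_ext => k km.
by rewrite tprojE// tprojE ?(leq_trans km)// tprojE.
Qed.

Lemma tproj_inv m g : (m <= n)%N -> tproj m (g^-1)%g = (tproj m g)^-1%g.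
Proof.
by move=> mn; apply: (mulgI (tproj m g)); rewrite -tproj_mul// !mulgV tproj_one.
Qed.

Lemma geometric2_le k : \sum_(i < k) 2 ^+ i <= 2 ^+ k :> R.
Proof.
elim: k => [|k ih]; first by rewrite big_ord0.
rewrite big_ord_recr/= exprS mulr_natl mulr2n.
by rewrite lerD2r.
Qed.

(** Solving (g g^-1)_k = 0 for g^-1_k gives
    g^-1_k = - \sum_(0 < i <= k) g_i g^-1_(k-i), so that the inverse coefficients
    are at most c_k N ^ k as soon as c_k dominates c_0 + ... + c_(k-1); c_k = 2 ^ k
    does. *)
Lemma norm_inv_coef_le g N : 0 <= N ->
  (forall k, (0 < k <= n)%N -> `|tser_of g k| <= N ^+ k) ->
  forall k, (k <= n)%N -> `|tser_of (g^-1)%g k| <= (2 * N) ^+ k.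
Proof.
move=> N0 gN k; elim: k {-2}k (leqnn k) => [|K ih] k kK kn.
  by move: kK; rewrite leqn0 => /eqP ->; rewrite norm_coef0.
case: k => [|k] in kK kn *; first by rewrite norm_coef0.
have : ((tser_of g : tser E) * tser_of (g^-1)%g) k.+1 = 0.
  by rewrite -trunc_mulE// mulgV tprojE.
rewrite serM big_ord_recl/= tser_of0 cmul1l => /eqP.
rewrite addr_eq0 => /eqP ->; rewrite normrN.
apply: (le_trans (ler_norm_sum _ _ _)).
apply: (@le_trans _ _ (\sum_(i < k.+1) 2 ^+ (k - i) * N ^+ k.+1)).
  apply: ler_sum => i _; apply: (le_trans (norm_cmul _ _ _)).
  have ik : (i <= k)%N by rewrite -ltnS.
  rewrite /bump leq0n add1n subSS.
  have -> : 2 ^+ (k - i) * N ^+ k.+1 = N ^+ i.+1 * (2 * N) ^+ (k - i).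
    rewrite exprMn mulrCA -exprD; congr (_ * N ^+ _).
    by rewrite addSn subnKC.
  apply: ler_pM => //; first by rewrite gN// (leq_trans _ kn).
  by rewrite ih// (leq_trans (leq_subr _ _))// ltnW.
rewrite -mulr_suml exprMn ler_wpM2r ?exprn_ge0//.
apply: le_trans (geometric2_le k.+1).
by rewrite (reindex_inj rev_ord_inj)/= ler_sum// => i _; rewrite subSS subKn// -ltnS.
Qed.

Lemma hnorm_ge0 g : 0 <= hnorm g.
Proof.
by rewrite /hnorm; elim/big_ind: _ => // *; rewrite ?powR_ge0// le_max; apply/orP; left.
Qed.

(** Trades the roots in hnorm for the powers in which products are estimated. *)
Lemma hnorm_leP g N : 0 <= N ->
  (forall k, (0 < k <= n)%N -> `|tser_of g k| <= N ^+ k) <-> hnorm g <= N.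
Proof.
move=> N0; split=> [gN|gN k /andP[k0 kn]].
  rewrite /hnorm big_nat_cond; apply: bigmax_le => // k /andP[/andP[k0 kn] _].
  have kR : k%:R != 0 :> R by rewrite pnatr_eq0 -lt0n.
  have -> : N = (N ^+ k) `^ k%:R^-1.
    by rewrite -powR_mulrn// -powRrM mulfV// powRr1.
  by apply: ge0_ler_powR; rewrite ?nnegrE ?exprn_ge0 ?invr_ge0 ?gN ?k0.
have kR : k%:R != 0 :> R by rewrite pnatr_eq0 -lt0n.
have : `|tser_of g k| `^ k%:R^-1 <= N.
  apply: le_trans gN; rewrite /hnorm.
  apply: (@le_bigmax_seq _ _ _ _ 0 k xpredT (fun k => `|tser_of g k| `^ k%:R^-1)) => //.
  by rewrite mem_index_iota k0.
move=> h.
rewrite -[leLHS]powRr1// -{1}(mulVf kR) powRrM powR_mulrn ?powR_ge0//.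
by rewrite lerXn2r ?nnegrE ?powR_ge0.
Qed.

Lemma coef_le_hnorm g k : (0 < k <= n)%N -> `|tser_of g k| <= hnorm g ^+ k.
Proof. by apply: (hnorm_leP g (hnorm_ge0 g)).2. Qed.

(** On the closure of the exponentials of Lie elements inversion preserves hnorm,
    by the antipode.  Lifts range over the whole truncated group, and there a
    constant factor is lost, which is harmless for finiteness of the
    p-variation. *)
Lemma hnorm_inv_le g : hnorm (g^-1)%g <= 2 * hnorm g.
Proof.
apply/hnorm_leP; first by rewrite mulr_ge0 ?hnorm_ge0.
move=> k /andP[_]; apply: norm_inv_coef_le; first exact: hnorm_ge0.
exact: coef_le_hnorm.
Qed.

End Coefficients.

(** * Continuity of paths *)

Section UniformContinuity.
Local Open Scope classical_set_scope.
Local Open Scope ring_scope.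
Variables (R : realType).

(** Heine-Cantor on a segment.  Having one modulus for all pairs of points is
    what both a reversal of time and a fine subdivision require. *)
Lemma within_continuous_uniformP (W : normedModType R) (T : R) (f : R -> W) :
  {within `[0, T], continuous f} <->
  forall e, 0 < e -> exists2 d, 0 < d & forall s t, s \in `[0, T] -> t \in `[0, T] ->
    `|s - t| < d -> `|f s - f t| < e.
Proof.
split=> [/subspace_continuousP cf e e0|uf]; last first.
  apply/subspace_continuousP => t tT; apply/cvgrPdist_lt => e /uf[d d0 fd].
  by rewrite near_withinE; exists d => //= s td sT; exact: fd.
have /compact_near_coveringP := @segment_compact R 0 T.
move=> /(_ R (0^'+) (fun d s => s \in `[0, T] -> forall t, t \in `[0, T] ->
    `|s - t| < d -> `|f s - f t| < e)).
case=> [x xT|r /= r0 fr].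
  have e20 : 0 < e / 2 by rewrite divr_gt0.
  have := cf x xT => /cvgrPdist_lt /(_ _ e20).
  rewrite near_withinE => -[d /= d0 xd].
  have d20 : 0 < d / 2 by rewrite divr_gt0.
  exists (ball x (d / 2), [set d' | d' < d / 2]); first split=> /=.
  - exact: nbhsx_ballx.
  - exact: nbhs_right_lt.
  case=> s d' /= [xs d'd] sT t tT st.
  have -> : f s - f t = (f x - f t) - (f x - f s).
    by rewrite opprB [RHS]addrC subrKA.
  rewrite (splitr e); apply: (le_lt_trans (ler_normB _ _)); apply: ltrD.
    apply: xd => //=; rewrite -[x - t](subrKA s) (splitr d).
    apply: (le_lt_trans (ler_normD _ _)); apply: ltrD => //.
    exact: lt_trans d'd.
  apply: xd => //=; apply: lt_trans xs _.
  by rewrite ltr_pdivrMr// ltr_pMr// ltr1n.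
exists (r / 2); first by rewrite divr_gt0.
move=> s t sT; apply: (fr (r / 2)) => //=; last by rewrite divr_gt0.
by rewrite sub0r normrN gtr0_norm ?divr_gt0// ltr_pdivrMr// ltr_pMr// ltr1n.
Qed.



End UniformContinuity.
Section Paths.
Local Open Scope classical_set_scope.
Local Open Scope ring_scope.
Variables (R : realType) (V : normedModType R) (A : normed_tensor_powers V).
Variable E : completed_tensor_powers A.
Variable n : nat.
Lemma within_continuous_coefP (T : R) (y : R -> trunc_tgroup E n) :
  {within `[0, T], continuous y} <->
  forall k, (k <= n)%N ->
    {within `[0, T], continuous (fun t => tser_of (y t) k)}.
Proof.
split=> [cy k _|cy].
  move=> t; apply: (@continuous_comp (subspace `[0, T]) (trunc_tgroup E n)
    (E k) y (fun g => tser_of g k)); [exact: cy|exact: coef_continuous].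
apply: (@continuous_comp_initial _ (subspace `[0, T]) _
  (fun g : trunc_tgroup E n => tser_of g : tser E) y).
move=> t; apply/cvg_sup => k.
apply: (@continuous_comp_initial _ (subspace `[0, T]) _ (proj k)
  (fun t => tser_of (y t) : tser E)).
have [/cy//|nk] := leqP k n.
rewrite (_ : _ \o _ = fun=> 0); first by move=> ?; exact: cvg_cst.
by apply: funext => s; apply: tgroup_ofP.
Qed.
End Paths.

(** * Paths of finite p-variation *)

Section Variation.
Variables (R : realType) (V : normedModType R) (A : normed_tensor_powers V).
Variable E : completed_tensor_powers A.
Variable n : nat.
Local Open Scope classical_set_scope.
Local Open Scope ring_scope.
Implicit Types y z : R -> trunc_tgroup E n.

(** Subdivisions are handled as strictly increasing sequences, which are easy to
    build and to reverse.  They may stop before T, so that the bound also serves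
    on every [0, t]. *)
Lemma pvariation_sum_bounded p T y : 0 < p -> finite_pvariation p T y ->
  exists2 M, 0 <= M & forall N (f : nat -> R), f 0%N = 0 ->
    (forall j, (j < N)%N -> f j < f j.+1) -> f N <= T ->
    \sum_(0 <= j < N) hnorm ((y (f j))^-1 * y (f j.+1))%g `^ p <= M.
Proof.
move=> p0 [M yM]; exists (`|M| `^ p); first exact: powR_ge0.
have full N (f : nat -> R) : f 0%N = 0 ->
    (forall j, (j < N)%N -> f j < f j.+1) -> f N = T ->
    \sum_(0 <= j < N) hnorm ((y (f j))^-1 * y (f j.+1))%g `^ p <= `|M| `^ p.
  move=> f0 fi fN.
  pose s := mkseq (fun j => f j.+1) N.
  have sN : size s = N by rewrite size_mkseq.
  have nthf j : (j <= N)%N -> nth T (0 :: s) j = f j.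
    by case: j => [|j] jN //=; rewrite nth_mkseq.
  have sT : itv_partition 0 T s.
    split; last by rewrite (last_nth T) sN nthf// fN.
    apply/(pathP T) => i; rewrite sN => iN.
    by rewrite nthf ?(ltnW iN)// -[nth T s i]/(nth T (0 :: s) i.+1) nthf// fi.
  set S := (X in X <= _).
  have SM : S `^ p^-1 <= M.
    apply: (@le_trans _ _ (pvariation p 0 T y s)); last by apply: yM; exists s.
    rewrite /pvariation sN le_eqVlt; apply/orP; left; apply/eqP.
    apply: (congr1 (fun u => u `^ p^-1)); apply: eq_big_nat => j jN.
    by rewrite (nthf j (ltnW jN)) (nthf j.+1 jN).
  have S0 : 0 <= S by apply: sumr_ge0 => *; exact: powR_ge0.
  rewrite -[leLHS]powRr1// -(mulVf (lt0r_neq0 p0)) powRrM.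
  apply: ge0_ler_powR; rewrite ?nnegrE ?powR_ge0 ?(ltW p0)//.
  by apply: le_trans SM _; exact: ler_norm.
move=> N f f0 fi; rewrite le_eqVlt => /orP[/eqP|fNT]; first exact: full.
(* Adding the point T yields a subdivision of the whole interval. *)
pose f' j := if (j <= N)%N then f j else T.
apply: (@le_trans _ _
    (\sum_(0 <= j < N.+1) hnorm ((y (f' j))^-1 * y (f' j.+1))%g `^ p)).
  rewrite big_nat_recr; last exact: leq0n.
  apply: ler_wpDr; first exact: powR_ge0.
  rewrite le_eqVlt; apply/orP; left; apply/eqP; apply: eq_big_nat => j /andP[_ jN].
  by rewrite /f' jN ltnW.
apply: full; rewrite /f' ?ltnn// => j; rewrite ltnS => jN; rewrite jN.
by case: ltnP => [/fi//|Nj]; rewrite (_ : j = N)//; apply/eqP; rewrite eqn_leq jN.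
Qed.

(** The subdivision {0, s} is enough, since y_0 = 1. *)
Lemma hnorm_path_bound p T y : 0 < p -> finite_pvariation p T y -> y 0 = 1%g ->
  exists2 m, 0 <= m & forall s, s \in `[0, T] -> hnorm (y s) <= m.
Proof.
move=> p0 /(pvariation_sum_bounded p0)[M M0 yM] y0; exists (M `^ p^-1); first exact: powR_ge0.
move=> s; rewrite in_itv/= => /andP[]; rewrite le_eqVlt => /predU1P[<- _|s0 sT].
  rewrite y0; apply/hnorm_leP; first exact: powR_ge0.
  move=> k /andP[k0 kn]; rewrite tprojE// (_ : tser_of _ k = 0) ?normr0 ?exprn_ge0 ?powR_ge0//.
  by case: k k0 {kn}.
have := yM 1%N (fun j => if j is 0%N then 0 else s) erefl.
rewrite big_nat1/= y0 invg1 mul1g => /(_ _ sT) h.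
rewrite -[leLHS]powRr1 ?hnorm_ge0// -(mulfV (lt0r_neq0 p0)) powRrM.
apply: ge0_ler_powR; rewrite ?nnegrE ?powR_ge0 ?invr_ge0 ?(ltW p0)//.
by apply: h => -[].
Qed.

Lemma inv_path_bound p T y : 0 < p -> finite_pvariation p T y -> y 0 = 1%g ->
  exists2 B, 0 < B & forall s k, s \in `[0, T] -> (k <= n)%N ->
    `|tser_of (y s)^-1%g k| <= B.
Proof.
move=> p0 yp y0; have [m m0 ym] := hnorm_path_bound p0 yp y0.
have m1 : 1 <= 2 * m + 1 by rewrite lerDr mulr_ge0.
exists ((2 * m + 1) ^+ n); first by rewrite exprn_gt0// (lt_le_trans ltr01).
move=> s k sT kn; apply: le_trans (ler_weXn2l m1 kn).
apply: (@le_trans _ _ ((2 * m) ^+ k)); last first.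
  by rewrite lerXn2r ?nnegrE ?addr_ge0 ?mulr_ge0// lerDl.
apply: norm_inv_coef_le => // j jn.
by move: j jn; apply/(hnorm_leP (y s) m0); exact: ym.
Qed.

Lemma path_uniform T y : {within `[0, T], continuous y} ->
  forall e, 0 < e -> exists2 d, 0 < d & forall s t, s \in `[0, T] ->
    t \in `[0, T] -> `|s - t| < d ->
    forall k, (k <= n)%N -> `|tser_of (y s) k - tser_of (y t) k| < e.
Proof.
move=> /within_continuous_coefP cy e e0.
have /choice[d dP] (k : 'I_n.+1) : exists d, 0 < d /\ forall s t,
    s \in `[0, T] -> t \in `[0, T] -> `|s - t| < d ->
    `|tser_of (y s) k - tser_of (y t) k| < e.
  by have /within_continuous_uniformP/(_ _ e0)[d d0 dP] := cy k (leq_ord k); exists d.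
exists (\big[Num.min/1]_(k < n.+1) d k).
  by apply: lt_bigmin => [|k _]; [exact: ltr01|case: (dP k)].
move=> s t sT tT /bigmin_gtP[_ st] k kn.
by have [_] := dP (Ordinal (kn : (k < n.+1)%N)); apply=> //; exact: st.
Qed.

(** For k > 0 the degree k coefficient of y_s^-1 y_t is that of
    y_s^-1 (y_t - y_s), where the first factor is bounded and the second one is
    uniformly small. *)
Lemma increments_small p T y : 0 < p -> {within `[0, T], continuous y} ->
  finite_pvariation p T y -> y 0 = 1%g ->
  forall e, 0 < e -> exists2 d, 0 < d & forall s t, s \in `[0, T] ->
    t \in `[0, T] -> `|s - t| < d -> hnorm ((y s)^-1 * y t)%g <= e.
Proof.
move=> p0 cy yp y0 e e0; have [B B0 yB] := inv_path_bound p0 yp y0.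
(* Capping e by 1 makes e' ^ n a lower bound for all the e' ^ k. *)
pose e' := Num.min e 1.
have e'0 : 0 < e' by rewrite lt_min e0 ltr01.
pose eta := e' ^+ n / (n.+1%:R * B).
have eta0 : 0 < eta by rewrite divr_gt0 ?exprn_gt0 ?mulr_gt0.
have [d d0 yd] := path_uniform cy eta0.
exists d => // s t sT tT st.
apply/hnorm_leP; first exact: ltW.
move=> k /andP[k0 kn].
have -> : tser_of ((y s)^-1 * y t)%g k =
    ((tser_of (y s)^-1%g : tser E) * (tser_of (y t) - tser_of (y s))) k.
  rewrite mulrBr serD serN -trunc_mulE// -trunc_mulE// mulVg.
  rewrite [X in _ - X](_ : _ = 0) ?subr0//.
  by rewrite tprojE//; case: k k0 {kn}.
apply: (le_trans (norm_smul_le _ _ _)).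
apply: (@le_trans _ _ (\sum_(i < k.+1) B * eta)).
  apply: ler_sum => i _; have ik := leq_ord i.
  apply: ler_pM => //; first by rewrite yB// (leq_trans ik).
  by rewrite serD serN distrC ltW// yd// (leq_trans (leq_subr _ _)).
rewrite sumr_const card_ord -mulr_natl.
apply: (@le_trans _ _ (n.+1%:R * (B * eta))).
  by apply: ler_wpM2r; [rewrite mulr_ge0 ?(ltW B0) ?(ltW eta0)|rewrite ler_nat].
rewrite mulrA /eta mulrCA mulfV ?mulr1; last first.
  by rewrite mulf_neq0 ?pnatr_eq0// lt0r_neq0.
apply: (@le_trans _ _ (e' ^+ k)).
  by apply: ler_wiXn2l => //; [exact: ltW|rewrite ge_min lexx orbT].
by rewrite lerXn2r ?nnegrE ?(ltW e0) ?(ltW e'0)// ge_min lexx.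
Qed.

(** With u = g^-1 h, the degree k.+1 coefficient of h = g u is the sum of those
    of g and u and of products of coefficients of degree at most k, which are
    common to both sides. *)
Lemma increment_coef_diff (g h g' h' : trunc_tgroup E n) k : (k < n)%N ->
  (forall j, (j <= k)%N -> tser_of g j = tser_of g' j) ->
  (forall j, (j <= k)%N -> tser_of h j = tser_of h' j) ->
  (tser_of h k.+1 - tser_of h' k.+1) - (tser_of g k.+1 - tser_of g' k.+1) =
  tser_of (g^-1 * h)%g k.+1 - tser_of (g'^-1 * h')%g k.+1.
Proof.
move=> kn gg hh.
have proj_eq (a b : trunc_tgroup E n) :
    (forall j, (j <= k)%N -> tser_of a j = tser_of b j) -> tproj k a = tproj k b.
  by move=> ab; apply: trunc_tgroup_ext => j jk; rewrite !tprojE// ab.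
pose u := (g^-1 * h)%g; pose u' := (g'^-1 * h')%g.
have uu j : (j <= k)%N -> tser_of u j = tser_of u' j.
  move=> jk; rewrite -(tprojE u jk) -(tprojE u' jk).
  rewrite !tproj_mul ?(ltnW kn)// !tproj_inv ?(ltnW kn)//.
  by rewrite (proj_eq _ _ gg) (proj_eq _ _ hh).
have hE : h = (g * u)%g by rewrite mulKVg.
have hE' : h' = (g' * u')%g by rewrite mulKVg.
rewrite -/u -/u' hE hE'; clearbody u u'.
rewrite !trunc_mulE// !smul_ends ?tser_of0//.
have -> : \sum_(i < k) pmul k.+1 (tser_of g i.+1) (tser_of u (k - i)%N) =
    \sum_(i < k) pmul k.+1 (tser_of g' i.+1) (tser_of u' (k - i)%N).
  by apply: eq_bigr => i _; rewrite gg ?uu// leq_subr.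
set S := \sum_(i < k) _.
rewrite addrAC opprB -[_ + _ + (_ - _)]addrA subrKC.
by rewrite -(addrA (tser_of u _)) -(addrA (tser_of u' _)) [tser_of u' _ + _]addrC addrKA.
Qed.

(** By induction on the degree K.+1.  Above p, the difference D of the two
    coefficients satisfies |D_t - D_s| <= eta times the terms of the two
    p-variation sums, for any eta > 0 once s and t are close, hence D is constant. *)
Lemma path_unique p T y z : 0 < p ->
  {within `[0, T], continuous y} -> {within `[0, T], continuous z} ->
  finite_pvariation p T y -> finite_pvariation p T z ->
  y 0 = 1%g -> z 0 = 1%g ->
  (forall t, t \in `[0, T] -> forall k, (k <= Num.truncn p)%N -> (k <= n)%N ->
    tser_of (y t) k = tser_of (z t) k) ->
  forall t, t \in `[0, T] -> y t = z t.
Proof.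
move=> p0 cy cz yp zp y0 z0 yz t tT; apply: trunc_tgroup_ext.
move=> k; elim: k {-2}k (leqnn k) t tT => [k|K ih k].
  by rewrite leqn0 => /eqP -> t tT _; rewrite !tser_of0.
rewrite leq_eqVlt => /predU1P[->{k}|]; last by rewrite ltnS; exact: ih.
have {}ih t k : (k <= K)%N -> t \in `[0, T] -> (k <= n)%N ->
    tser_of (y t) k = tser_of (z t) k by move=> *; exact: ih.
move=> t tT Kn; have [Kp|pK] := leqP K.+1 (Num.truncn p); first exact: yz.
have Kp : 0 < K.+1%:R - p by rewrite subr_gt0 -truncn_le_nat.
have [My My0 yM] := pvariation_sum_bounded p0 yp.
have [Mz Mz0 zM] := pvariation_sum_bounded p0 zp.
move: (tT); rewrite in_itv/= => /andP[]; rewrite le_eqVlt => /predU1P[<- _|t0 tleT].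
  by rewrite y0 z0.
pose D s := tser_of (y s) K.+1 - tser_of (z s) K.+1.
suff DM eta : 0 < eta -> `|D t| <= eta * (My + Mz).
  apply/eqP; rewrite -subr_eq0 -normr_le0 -/(D t).
  apply/ler_addgt0Pr => e e0; rewrite add0r.
  have M1 : 0 < My + Mz + 1 by rewrite ltr_wpDl// addr_ge0.
  apply: le_trans (DM (e / (My + Mz + 1)) _) _; first by rewrite divr_gt0.
  by rewrite mulrAC ler_pdivrMr// ler_wpM2l ?(ltW e0)// lerDl.
(* hnorm ^ K.+1 = hnorm ^ (K.+1 - p) * hnorm ^ p, and the first factor is at
   most eta when hnorm <= e. *)
move=> eta0; pose e := eta `^ (K.+1%:R - p)^-1.
have e0 : 0 < e by exact: powR_gt0.
have [d1 d10 yd] := increments_small p0 cy yp y0 e0.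
have [d2 d20 zd] := increments_small p0 cz zp z0 e0.
pose d := Num.min d1 d2; have d0 : 0 < d by rewrite lt_min d10.
pose N := (Num.truncn (t / d)).+1.
have N0 : 0 < N%:R :> R by rewrite ltr0n.
have tN : t / N%:R < d.
  by rewrite ltr_pdivrMr// mulrC -ltr_pdivrMr// truncnS_gt.
pose f j := t * (j%:R / N%:R).
have f0 : f 0%N = 0 by rewrite /f mul0r mulr0.
have fN : f N = t by rewrite /f mulfV ?mulr1// lt0r_neq0.
have fS j : f j.+1 - f j = t / N%:R.
  by rewrite /f -mulrBr -mulrBl -natrB// subSnn mul1r.
have f_lt j : f j < f j.+1 by rewrite -subr_gt0 fS divr_gt0.
have fT j : (j <= N)%N -> f j \in `[0, T].
  move=> jN; rewrite in_itv/= mulr_ge0 ?divr_ge0 ?(ltW t0)//=.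
  by apply: le_trans tleT; rewrite ler_piMr ?(ltW t0)// ler_pdivrMr// mul1r ler_nat.
have f_close j : `|f j - f j.+1| < d.
  by rewrite distrC fS gtr0_norm ?divr_gt0.
have small (w : R -> trunc_tgroup E n) j :
    hnorm ((w (f j))^-1 * w (f j.+1))%g <= e ->
    `|tser_of ((w (f j))^-1 * w (f j.+1))%g K.+1| <=
    eta * hnorm ((w (f j))^-1 * w (f j.+1))%g `^ p.
  move=> we; apply: (le_trans (coef_le_hnorm _ _)); first by rewrite Kn.
  set N1 := hnorm _ in we *; have N10 : 0 <= N1 by exact: hnorm_ge0.
  have -> : N1 ^+ K.+1 = N1 `^ (K.+1%:R - p) * N1 `^ p.
    by rewrite -powRD ?subrK ?powR_mulrn// gt_eqF ?ltr0n.
  rewrite ler_wpM2r ?powR_ge0//.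
  have -> : eta = e `^ (K.+1%:R - p).
    by rewrite /e -powRrM mulVf ?lt0r_neq0// powRr1// ltW.
  by apply: ge0_ler_powR; rewrite ?nnegrE ?(ltW Kp) ?(ltW e0).
have -> : D t = \sum_(0 <= j < N) (D (f j.+1) - D (f j)).
  rewrite (telescope_sumr (fun j => D (f j)))// fN f0.
  by rewrite [X in _ - X](_ : _ = 0) ?subr0// /D y0 z0 subrr.
apply: (le_trans (ler_norm_sum _ _ _)).
have : eta * (\sum_(0 <= j < N) hnorm ((y (f j))^-1 * y (f j.+1))%g `^ p
    + \sum_(0 <= j < N) hnorm ((z (f j))^-1 * z (f j.+1))%g `^ p) <=
    eta * (My + Mz).
  apply: ler_wpM2l; first exact: ltW.
  have fNT : f N <= T by rewrite fN.
  by apply: lerD; [exact: (yM _ f f0)|exact: (zM _ f f0)].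
apply: le_trans; rewrite -big_split/= mulr_sumr.
rewrite big_nat [leRHS]big_nat; apply: ler_sum => j /andP[_ jN].
rewrite /D (increment_coef_diff Kn); last 2 first.
- by move=> i iK; apply: ih; rewrite ?fT ?(ltnW jN)// (leq_trans iK)// ltnW.
- by move=> i iK; apply: ih; rewrite ?fT// (leq_trans iK)// ltnW.
rewrite mulrDr; apply: (le_trans (ler_normB _ _)); apply: lerD; apply: small.
- apply: yd; rewrite ?fT ?(ltnW jN)//.
  by apply: lt_le_trans (f_close j) _; rewrite ge_min lexx.
- apply: zd; rewrite ?fT ?(ltnW jN)//.
  by apply: lt_le_trans (f_close j) _; rewrite ge_min lexx orbT.
Qed.

End Variation.

(** * Time reversal *)

Section Reversal.
Variables (R : realType) (V : normedModType R) (A : normed_tensor_powers V).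
Variable E : completed_tensor_powers A.
Local Open Scope classical_set_scope.
Local Open Scope ring_scope.

Lemma reverse_in_itv (T t : R) : t \in `[0, T] -> T - t \in `[0, T].
Proof.
by rewrite !in_itv/= => /andP[t0 tT]; rewrite subr_ge0 tT gerBl.
Qed.

Lemma reverseK n T (x : R -> trunc_tgroup E n) : reverse T (reverse T x) = x.
Proof. by apply: funext => t; rewrite /reverse subKr. Qed.

(** Left translation by g changes the differences of coefficients by a factor
    of at most the sum of the norms of the coefficients of g. *)
Lemma within_reverse n T g (y : R -> trunc_tgroup E n) :
  {within `[0, T], continuous y} ->
  {within `[0, T], continuous (fun t => g * reverse T y t)%g}.
Proof.
move=> cy; apply/within_continuous_coefP => k kn; apply/within_continuous_uniformP => e e0.
pose S := \sum_(i < k.+1) `|tser_of g i|.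
have S0 : 0 <= S by exact: sumr_ge0.
have S1 : 0 < S + 1 by rewrite ltr_wpDl.
have [d d0 yd] := path_uniform cy (divr_gt0 e0 S1).
exists d => // s t sT tT st; rewrite !trunc_mulE// -serN -serD -mulrBr.
apply: (le_lt_trans (norm_smul_le _ _ _)).
apply: (@le_lt_trans _ _ (S * (e / (S + 1)))).
  rewrite mulr_suml; apply: ler_sum => i _; rewrite ler_wpM2l//.
  rewrite serD serN ltW//; apply: yd; rewrite ?reverse_in_itv//.
    by rewrite opprB addrC subrKA distrC.
  exact: leq_trans (leq_subr _ _) kn.
by rewrite mulrCA gtr_pMr// ltr_pdivrMr// mul1r ltrDl.
Qed.

Lemma finite_pvariation_reverse n p T g (y : R -> trunc_tgroup E n) : 0 < p ->
  finite_pvariation p T y ->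
  finite_pvariation p T (fun t => g * reverse T y t)%g.
Proof.
move=> p0 /(pvariation_sum_bounded p0)[M M0 yM].
exists ((2 `^ p * M) `^ p^-1) => _ [s [sP sT] <-].
pose t := nth T (0 :: s).
have sN : t (size s) = T by rewrite /t -last_nth; apply/eqP.
have tS j : (j < size s)%N -> t j < t j.+1 by move=> js; exact: (pathP T sP j js).
(* The subdivision s reflected in the midpoint of [0, T]. *)
pose f j := T - t (size s - j)%N.
have f0 : f 0%N = 0 by rewrite /f subn0 sN subrr.
have fS j : (j < size s)%N -> f j < f j.+1.
  by move=> js; rewrite /f ltrD2l ltrN2 -(subnSK js) tS// ltn_subrL (leq_ltn_trans _ js).
have fN : f (size s) <= T by rewrite /f subnn /t /= subr0.
rewrite /pvariation -/t.
have le_sum : \sum_(0 <= j < size s) hnorm ((g * reverse T y (t j))^-1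
    * (g * reverse T y (t j.+1)))%g `^ p <= 2 `^ p * M.
  apply: (@le_trans _ _ (2 `^ p *
      \sum_(0 <= j < size s) hnorm ((y (f j))^-1 * y (f j.+1))%g `^ p)).
    rewrite mulr_sumr big_nat_rev big_nat [leRHS]big_nat.
    apply: ler_sum => j /andP[_ js]; rewrite add0n subnSK//.
    rewrite invgM -!mulgA mulKg -powRM ?hnorm_ge0//.
    apply: ge0_ler_powR; rewrite ?nnegrE ?mulr_ge0 ?hnorm_ge0 ?(ltW p0)//.
    have := hnorm_inv_le ((y (f j))^-1 * y (f j.+1))%g.
    by rewrite invgM invgK.
  by rewrite ler_wpM2l ?powR_ge0// yM.
by apply: ge0_ler_powR; rewrite ?nnegrE ?invr_ge0 ?(ltW p0) ?mulr_ge0 ?powR_ge0//;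
  apply: sumr_ge0 => *; exact: powR_ge0.
Qed.

Section Lifts.
Variables (p T : R) (x : R -> trunc_tgroup E (Num.truncn p)).
Hypotheses (p0 : 0 < p) (T0 : 0 <= T).
Variable n : nat.
Hypothesis pn : (Num.truncn p <= n)%N.

Lemma is_lift_reverse y : is_lift p T x n y ->
  is_lift p T (reverse T x) n (fun t => (y T)^-1 * reverse T y t)%g.
Proof.
have TT : T \in `[0, T] by rewrite in_itv/= T0 lexx.
move=> [cy yp y0 yx]; split.
- exact: within_reverse.
- exact: finite_pvariation_reverse.
- by rewrite /reverse subr0 mulVg.
- move=> t tT; rewrite tproj_mul// tproj_inv// /reverse !yx ?reverse_in_itv//.
  by rewrite subr0 invgM invgK -mulgA mulKVg.
Qed.

Lemma is_lift_unique y z : is_lift p T x n y -> is_lift p T x n z ->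
  forall t, t \in `[0, T] -> y t = z t.
Proof.
move=> [cy yp y0 yx] [cz zp z0 zx]; apply: (path_unique p0) => // t tT k kp _.
by rewrite -(tprojE (y t) kp) yx// -zx// tprojE.
Qed.

End Lifts.

(** When x has no lift, neither has its reversal, and both sides are 1. *)
Lemma lyons_lift_reverse p T (x : R -> trunc_tgroup E (Num.truncn p)) n :
  0 < p -> 0 <= T -> (Num.truncn p <= n)%N ->
  lyons_lift p T (reverse T x) n T = (lyons_lift p T x n T)^-1%g.
Proof.
move=> p0 T0 pn; have TT : T \in `[0, T] by rewrite in_itv/= T0 lexx.
have [[y yP]|no_lift] := pselect (exists y, is_lift p T x n y).
  have lP : is_lift p T x n (lyons_lift p T x n) by apply: xgetPex; exists y.
  have rP := is_lift_reverse p0 T0 pn lP.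
  have lrP : is_lift p T (reverse T x) n (lyons_lift p T (reverse T x) n).
    by apply: xgetPex; eexists; exact: rP.
  rewrite (is_lift_unique p0 lrP rP TT) /reverse subrr.
  by have [_ _ -> _] := lP; rewrite mulg1.
rewrite /lyons_lift !xgetPN ?invg1// => y yP; first by apply: no_lift; exists y.
apply: no_lift; exists (fun t => (y T)^-1 * reverse T y t)%g.
by rewrite -[x](reverseK T); exact: is_lift_reverse.
Qed.

Lemma eq_tproj_from m (S S' : tgroup E) :
  (forall n, (m <= n)%N -> tproj n S = tproj n S') -> S = S'.
Proof.
move=> SS; apply: tgroup_ext => k.
rewrite -(tprojE S (leq_maxr m k)) -(tprojE S' (leq_maxr m k)).
by rewrite SS ?leq_maxl.
Qed.

Lemma tproj_tgroup_inv n (S : tgroup E) : tproj n (S^-1)%g = (tproj n S)^-1%g.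
Proof.
apply: (mulgI (tproj n S)); rewrite mulgV.
apply: trunc_tgroup_ext => k kn; rewrite !tprojE// -(mulgV S).
by apply: (@smul_agree _ _ _ E n) => // j jn; rewrite tprojE.
Qed.

End Reversal.

Theorem lemma1p4 (R : realType) (V : completeNormedModType R)
    (A : normed_tensor_powers V) (E : completed_tensor_powers A)
    (p T : R) (hp : 1 <= p) (hT : 0 < T)
    (x : R -> trunc_tgroup E (Num.truncn p))
    (hx : weakly_geometric_rough_path p T x) :
  signature p T (reverse T x) = (signature p T x)^-1%g.
Proof.
have p0 : 0 < p by exact: lt_le_trans hp.
have rev := lyons_lift_reverse x p0 (ltW hT).
pose sigs x := [set S : tgroup E | forall n, (Num.truncn p <= n)%N ->
  tproj n S = lyons_lift p T x n T]%classic.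
have sigs_inv S : sigs x S -> sigs (reverse T x) (S^-1)%g.
  by move=> SP n pn; rewrite tproj_tgroup_inv SP// rev.
have [[S SP]|no_sig] := pselect (exists S, sigs x S).
  have xS : sigs x (signature p T x) by apply: xgetPex; exists S.
  have rS : sigs (reverse T x) (signature p T (reverse T x)).
    by apply: xgetPex; exists (S^-1)%g; exact: sigs_inv.
  by apply: (@eq_tproj_from _ _ _ _ (Num.truncn p)) => n pn; rewrite rS// sigs_inv.
rewrite /signature !xgetPN ?invg1// => S SP; apply: no_sig; first by exists S.
by exists (S^-1)%g => n pn; rewrite tproj_tgroup_inv SP// rev// invgK.
Qed.
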